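(* Let $p=p(n)\in(0,1]$ with $p(n)\to0$ and $p=n^{-o(1)}$, and let $(G_n)$ be a sequence of graphs with $|G_n|=n$, $e(G_n)=p\binom n2$, $s_p(C_4,G_n)\to1$, and $\sup_n s_p(H,G_n)<\infty$ for each fixed graph $H$. Let $F$ be any fixed graph with girth at least $4$ (i.e. triangle-free), and let $F'\ne F$ be any induced subgraph of $F$. Then $F$ is flat over $F'$. Furthermore, $s_p(F,G_n)\to1$ and $t_p(F,G_n)\to1$ as $n\to\infty$.
   Context: Graphs are finite and simple; $|G|$ and $e(G)$ are the numbers of vertices and edges. A sequence $(G_n)$ with $|G_n|=n$ need only be defined for $n$ in an infinite subset of $\mathbb{N}$; limits are along that subset. $p=n^{-o(1)}$ means that for every $\varepsilon>0$, $p(n)\ge n^{-\varepsilon}$ for all large $n$. $\mathrm{emb}(F,G)$ and $\hom(F,G)$ are the numbers of injective homomorphisms and of homomorphisms from $F$ to $G$. For $|G|=n$ and $p=p(n)$, $s_p(F,G)=\mathrm{emb}(F,G)/(p^{e(F)}n_{(|F|)})$, where $n_{(k)}=n(n-1)\cdots(n-k+1)$ (with $s_p(F,G)=0$ if $|F|>n$), and $t_p(F,G)=\hom(F,G)/(p^{e(F)}n^{|F|})$. Flatness: for a subgraph $F'$ of $F$, let $\phi$ be chosen uniformly at random from all homomorphisms from $F'$ to $G_n$ (if there are any), and let $Z_n(F',F)$ be the number of extensions of $\phi$ to a homomorphism from $F$ to $G_n$, divided by $n^{|F|-|F'|}p^{e(F)-e(F')}$. ($F'$ may be the graph with no vertices,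 in which case $Z_n(F',F)=t_p(F,G_n)$.) $F$ is flat over $F'$ (in $(G_n)$) if $Z_n(F',F)\to1$ in probability as $n\to\infty$. *)

(* Defs.v *)
From HB Require Import structures.
From mathcomp Require Import all_boot all_order all_algebra.
From mathcomp Require Import all_classical all_reals all_analysis.

Set Implicit Arguments.
Unset Strict Implicit.
Unset Printing Implicit Defensive.

Import Order.TTheory GRing.Theory Num.Theory numFieldNormedType.Exports.

Local Open Scope ring_scope.

Record sgraph := SGraph {
  svertex :> finType;
  sedge : rel svertex;
  sedge_sym : symmetric sedge;
  sedge_irrefl : irreflexive sedge }.

Arguments sedge {s}.

Definition edge_set (G : sgraph) : {set {set G}} :=
  [set e : {set G} | [exists x, exists y, sedge x y && (e == [set x; y])]].

Definition nb_edges (G : sgraph) : nat := #|edge_set G|.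

(* Only cycles of length at least 3 count, since [cycle] also accepts the empty
   sequence and x, y, x along an edge.  A forest satisfies this for every g. *)
Definition girth_at_least (F : sgraph) (g : nat) : Prop :=
  forall c : seq F, (2 < size c)%N -> ucycle sedge c -> (g <= size c)%N.

Definition C4_rel : rel 'I_4 := fun i j => (j == ordS i) || (i == ordS j).

Lemma C4_rel_sym : symmetric C4_rel.
Proof. by move=> i j; rewrite /C4_rel orbC. Qed.

Lemma C4_rel_irrefl : irreflexive C4_rel.
Proof. by case=> [] [|[|[|[|]]]]. Qed.

Definition C4 : sgraph := SGraph C4_rel_sym C4_rel_irrefl.

(* A subgraph need not be induced. *)
Record subgraph (F : sgraph) := Subgraph {
  sub_verts : {set F};
  sub_edge : rel F;
  sub_edge_sym : symmetric sub_edge;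
  sub_edgeP : forall x y, sub_edge x y ->
    [&& sedge x y, x \in sub_verts & y \in sub_verts] }.

Section SubgraphAsGraph.
Variables (F : sgraph) (F' : subgraph F).

Let V := {x : F | x \in sub_verts F'}.
Let E : rel V := fun x y => sub_edge F' (val x) (val y).

Fact graph_of_sub_sym : symmetric E.
Proof. by move=> x y; exact: sub_edge_sym. Qed.

Fact graph_of_sub_irrefl : irreflexive E.
Proof.
move=> x; apply/negbTE/negP => /sub_edgeP /and3P[].
by rewrite sedge_irrefl.
Qed.

Definition graph_of_sub : sgraph := SGraph graph_of_sub_sym graph_of_sub_irrefl.

End SubgraphAsGraph.

Coercion graph_of_sub : subgraph >-> sgraph.

Section Induced.
Variables (F : sgraph) (S : {set F}).

Let E : rel F := fun x y => [&& sedge x y, x \in S & y \in S].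

Fact induced_sym : symmetric E.
Proof. by move=> x y; rewrite /E sedge_sym [(y \in S) && _]andbC. Qed.

Fact inducedP x y : E x y -> [&& sedge x y, x \in S & y \in S].
Proof. by []. Qed.

Definition induced_subgraph : subgraph F := Subgraph induced_sym inducedP.

End Induced.

Definition is_hom (F G : sgraph) (f : {ffun F -> G}) : bool :=
  [forall x, forall y, sedge x y ==> sedge (f x) (f y)].

Definition hom_set (F G : sgraph) : {set {ffun F -> G}} :=
  [set f : {ffun F -> G} | is_hom f].

Definition emb_set (F G : sgraph) : {set {ffun F -> G}} :=
  [set f in hom_set F G | injectiveb f].

Definition nb_hom (F G : sgraph) : nat := #|hom_set F G|.
Definition nb_emb (F G : sgraph) : nat := #|emb_set F G|.

Definition ext_set (F : sgraph) (F' : subgraph F) (G : sgraph)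
    (phi : {ffun F' -> G}) : {set {ffun F -> G}} :=
  [set psi in hom_set F G | [forall x : F', psi (val x) == phi x]].

Section Counts.
Variable R : realType.

(* The falling factorial vanishes when #|F| > #|G|; as x / 0 = 0, the value is
   then 0. *)
Definition s_ (p : R) (F G : sgraph) : R :=
  (nb_emb F G)%:R / (p ^+ nb_edges F * (#|G| ^_ #|F|)%:R).

Definition t_ (p : R) (F G : sgraph) : R :=
  (nb_hom F G)%:R / (p ^+ nb_edges F * #|G|%:R ^+ #|F|).

Definition Z_ (p : R) (F : sgraph) (F' : subgraph F) (G : sgraph)
    (phi : {ffun F' -> G}) : R :=
  #|ext_set phi|%:R /
    (#|G|%:R ^+ (#|F| - #|F'|) * p ^+ (nb_edges F - nb_edges F')).

(* The probability that a uniformly random element of A satisfies P; it is 0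
   when A is empty. *)
Definition unif_prob (T : finType) (A : {set T}) (P : pred T) : R :=
  #|[set x in A | P x]|%:R / #|A|%:R.

Local Open Scope classical_set_scope.

(* Convergence to 1 in probability, along the index set N.  It is phrased by
   P(|Z - 1| <= eps) -> 1 rather than P(|Z - 1| > eps) -> 0, so that a sequence
   with no homomorphism from F' to G n for infinitely many n in N is not flat. *)
Definition flat (N : set nat) (p : nat -> R) (G : nat -> sgraph)
    (F : sgraph) (F' : subgraph F) : Prop :=
  forall eps : R, 0 < eps ->
    unif_prob (hom_set F' (G n)) (fun phi => `|Z_ (p n) phi - 1| <= eps)
      @[n --> within N \oo] --> (1 : R).

End Counts.

(* Main.v *)
Require Import Defs.
From mathcomp Require Import all_boot all_order all_algebra.
From mathcomp Require Import all_classical all_reals all_analysis.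
From mathcomp Require Import lra ring zify.
Import Order.TTheory GRing.Theory Num.Theory numFieldNormedType.Exports.

Set Implicit Arguments.
Unset Strict Implicit.
Unset Printing Implicit Defensive.

(** Write t for the normalized homomorphism density and, for x in V^a, let S(x)
    be the number of common neighbours of x_1, ..., x_a divided by its
    expected value n p^a.  Then t(K_{a,b}) is the b-th moment of S over V^a, and
    the symmetry K_{a,b} = K_{b,a} exchanges the roles of a and b.

    Since p^-e = o(n) for every e, maps that are not injective contribute o(1)
    to t, hence t - s -> 0 for every graph ([cvg_t_sub_s]); in particular all
    densities t(H) are bounded and t(C4) -> 1.

    By Cauchy-Schwarz, t(K_{1,1})^2 <= t(K_{1,2}) and
    t(K_{1,2})^2 <= t(K_{2,2}), so these three densities tend to 1: degrees and
    codegrees concentrate in mean square.  Their higher moments are bounded,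
    so they tend to 1 too ([cvg_moment]).  Reading t(K_{1,a}) and t(K_{2,a}) as
    the first two moments of S over V^a gives E (S - 1)^2 -> 0 for every a > 0
    ([cvg_deviation_bipartite]).

    Now let v be a vertex of a triangle-free graph F with a > 0 neighbours,
    and let F0 be F with the edges at v removed.  Conditioning on the images x of
    the neighbours of v, t(F) - t(F0) is the average over V^a of D(x)(S(x) - 1),
    where D(x) is the normalized number of extensions of x to a homomorphism
    of F0.  The neighbours of v are pairwise non-adjacent, so E D^2 is exactly
    the density of two copies of F0 glued along them, which is bounded; by
    Cauchy-Schwarz t(F) - t(F0) -> 0 ([isolate_ineq]).  Induction on the number
    of edges gives t(F) -> 1 ([cvg_t]).

    Flatness is then the second moment method: over the homomorphisms of an
    induced subgraph F', Z has mean t(F)/t(F') and second moment t(H)/t(F'), where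
    H is two copies of F glued along F' ([Z_deviation]).  As H is again
    triangle-free, both tend to 1. *)

Local Open Scope nat_scope.

(** * Edges and homomorphisms *)

(** Ordered pairs of adjacent vertices: unlike the set of edges, this is a
    double sum that splits along any decomposition of the vertex set. *)
Definition nb_arcs (F : sgraph) : nat := \sum_(x : F) \sum_(y : F) sedge x y.

Lemma nb_arcsE (F : sgraph) : nb_arcs F = (nb_edges F).*2.
Proof.
rewrite /nb_arcs /nb_edges pair_big /= -big_mkcond /=.
rewrite (partition_big (fun u : F * F => [set u.1; u.2]%SET) (mem (edge_set F)))
  => [|[x y] /= xy]; last first.
  by rewrite inE; apply/existsP; exists x; apply/existsP; exists y; rewrite xy /=.
rewrite -muln2 -sum_nat_const; apply: eq_bigr => e.
rewrite /= inE => /existsP[a /existsP[b /andP[ab /eqP->]]].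
have anb : a != b by apply: contraL ab => /eqP->; rewrite sedge_irrefl.
rewrite sum1_card.
have -> : 2 = #|[set (a, b); (b, a)]%SET|.
  by rewrite cards2 xpair_eqE negb_and anb.
apply: eq_card => -[x y]; rewrite !inE /= !xpair_eqE.
rewrite /in_mem /=.
apply/andP/idP => [[xy /eqP E]|].
  have xny : x != y by apply: contraL xy => /eqP->; rewrite sedge_irrefl.
  have xab : x \in [set a; b]%SET by rewrite -E !inE eqxx.
  have yab : y \in [set a; b]%SET by rewrite -E !inE eqxx orbT.
  move: xab yab xny; rewrite !inE.
  by do 2![case/orP => /eqP->]; rewrite ?eqxx ?orbT.
case/orP => /andP[/eqP-> /eqP->]; first by rewrite ab eqxx.
by rewrite sedge_sym ab finset.setUC eqxx.
Qed.

Lemma nb_homE (F G : sgraph) :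
  nb_hom F G = \sum_(f : {ffun F -> G}) is_hom f.
Proof.
by rewrite /nb_hom -sum1_card big_mkcond; apply: eq_bigr => f _; rewrite inE; case: is_hom.
Qed.

Lemma is_homP (F G : sgraph) (f : {ffun F -> G}) :
  reflect (forall x y, sedge x y -> sedge (f x) (f y)) (is_hom f).
Proof.
apply: (iffP forallP) => [h x y xy|h x].
  by have /forallP /(_ y) /implyP := h x; exact.
by apply/forallP => y; apply/implyP => /h.
Qed.

Section Isomorphism.
Variables (F F' : sgraph) (phi : F -> F').
Hypotheses (phi_bij : bijective phi)
  (phi_edge : forall x y, sedge (phi x) (phi y) = sedge x y).

Lemma nb_edges_iso : nb_edges F = nb_edges F'.
Proof.
apply: double_inj; rewrite -!nb_arcsE /nb_arcs.
rewrite [RHS](reindex phi) /=; last exact: onW_bij.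
apply: eq_bigr => x _; rewrite [RHS](reindex phi) /=; last exact: onW_bij.
by apply: eq_bigr => y _; rewrite phi_edge.
Qed.

Lemma nb_hom_iso (G : sgraph) : nb_hom F G = nb_hom F' G.
Proof.
case: phi_bij => psi phiK psiK; rewrite !nb_homE.
rewrite (reindex (fun f : {ffun F' -> G} => [ffun x => f (phi x)])) /=.
  apply: eq_bigr => f _; congr nat_of_bool; apply/is_homP/is_homP => h x y xy.
    have := h (psi x) (psi y); rewrite !ffunE !psiK; apply.
    by rewrite -phi_edge !psiK.
  by rewrite !ffunE; apply: h; rewrite phi_edge.
apply: onW_bij; exists (fun f : {ffun F -> G} => [ffun x => f (psi x)]) => f;
by apply/ffunP => x; rewrite !ffunE ?phiK ?psiK.
Qed.

End Isomorphism.

Definition triangle_free (F : sgraph) :=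
  forall x y z : F, sedge x y -> sedge y z -> sedge z x -> False.

Lemma girth4_triangle_free (F : sgraph) : girth_at_least F 4 -> triangle_free F.
Proof.
move=> F4 x y z xy yz zx; suff: 4 <= size [:: x; y; z] by [].
apply: F4 => //; rewrite /ucycle /= xy yz zx /= !inE.
rewrite andbT negb_or; apply/andP; split; first apply/andP; first split.
- by apply: contraTneq xy => ->; rewrite sedge_irrefl.
- by apply: contraTneq zx => ->; rewrite sedge_irrefl.
- by apply: contraTneq yz => ->; rewrite sedge_irrefl.
Qed.

Lemma induced_triangle_free (F : sgraph) (S : {set F}) :
  triangle_free F -> triangle_free (induced_subgraph S).
Proof.
by move=> F3 x y z /and3P[xy _ _] /and3P[yz _ _] /and3P[zx _ _]; exact: (F3 _ _ _ xy yz zx).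
Qed.

Lemma card_induced (F : sgraph) (S : {set F}) : #|induced_subgraph S| = #|S|.
Proof. by rewrite card_sig; apply: eq_card => x; rewrite !inE. Qed.

(** * Gluing two copies of a graph along a set of vertices *)

Lemma sum_val (T : finType) (A : {set T}) (c : T -> nat) :
  \sum_(x : {x : T | x \in A}) c (val x) = \sum_x (x \in A) * c x.
Proof.
rewrite -(@big_sub _ _ _ _ (mem A) c) big_mkcond.
by apply: eq_bigr => x _; case: (x \in A); rewrite ?mul1n ?mul0n.
Qed.

Lemma nb_arcs_induced (F : sgraph) (S : {set F}) :
  nb_arcs (induced_subgraph S) =
  \sum_x (x \in S) * \sum_y (y \in S) * sedge x y.
Proof.
rewrite -(sum_val S (fun x => \sum_y (y \in S) * sedge x y)).
apply: eq_bigr => x _; rewrite -(sum_val S (fun y => nat_of_bool (sedge (val x) y))).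
apply: eq_bigr => y _; congr nat_of_bool.
by rewrite /sedge /= (valP x) (valP y) !andbT.
Qed.

Lemma nb_edges_induced (F : sgraph) (S : {set F}) :
  nb_edges (induced_subgraph S) <= nb_edges F.
Proof.
rewrite -leq_double -!nb_arcsE nb_arcs_induced; apply: leq_sum => x _.
rewrite big_distrr /=; apply: leq_sum => y _.
by case: (x \in S); case: (y \in S); rewrite ?mul1n.
Qed.

(* doubling *)
Section Double.
Variables (F : sgraph) (S : {set F}).

(** [inl] is the first copy of F; the second copy shares S with it, so only its
    vertices outside S are new. *)
Definition doubling_vertex : finType := (F + {x : F | x \in ~: S})%type.

Definition doubling_rel (u v : doubling_vertex) : bool :=
  match u, v with
  | inl x, inl y => sedge x y
  | inl x, inr y => (x \in S) && sedge x (val y)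
  | inr x, inl y => (y \in S) && sedge (val x) y
  | inr x, inr y => sedge (val x) (val y)
  end.

Fact doubling_rel_sym : symmetric doubling_rel.
Proof. by move=> [x|x] [y|y]; rewrite /= sedge_sym. Qed.

Fact doubling_rel_irrefl : irreflexive doubling_rel.
Proof. by move=> [x|x]; rewrite /= sedge_irrefl. Qed.

Definition doubling : sgraph := SGraph doubling_rel_sym doubling_rel_irrefl.

Definition copy2 (x : F) : doubling :=
  if insub x is Some y then inr y else inl x.

Lemma copy2_in x : x \in S -> copy2 x = inl x.
Proof. by move=> xS; rewrite /copy2 insubF // inE xS. Qed.

Lemma copy2_val (y : {x : F | x \in ~: S}) : copy2 (val y) = inr y.
Proof. by rewrite /copy2 valK. Qed.

Lemma copy2_edge x y : sedge (copy2 x) (copy2 y) = sedge x y.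
Proof.
rewrite /copy2; case: (insubP _ x) => [u|] xS; case: (insubP _ y) => [v|] yS //=.
- by move=> -> ->.
- by move=> ->; move: yS; rewrite inE negbK => ->.
- by move=> ->; move: xS; rewrite inE negbK => ->.
Qed.

Lemma card_doubling : #|doubling| + #|S| = #|F| + #|F|.
Proof.
rewrite [X in X + _]card_sum card_sig -addnA; congr (_ + _).
by rewrite -(cardsC S) addnC.
Qed.

(** Each arc of F occurs once per copy, except that the arcs inside S are shared
    by the two copies. *)
Lemma nb_arcs_doubling :
  nb_arcs doubling + nb_arcs (induced_subgraph S) = (nb_arcs F).*2.
Proof.
rewrite nb_arcs_induced {1}/nb_arcs big_sumType /=.
under eq_bigr => x _ do rewrite big_sumType /=.
under [X in _ + X + _]eq_bigr => x _ do rewrite big_sumType /=.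
under eq_bigr => x _ do
  rewrite (sum_val _ (fun y => nat_of_bool ((x \in S) && sedge x y))).
under [X in _ + X + _]eq_bigr => x _ do
  rewrite (sum_val _ (fun y => nat_of_bool (sedge (val x) y))).
rewrite (sum_val _ (fun x => \sum_y nat_of_bool ((y \in S) && sedge x y) +
   \sum_y (y \in ~: S) * nat_of_bool (sedge x y))).
rewrite /nb_arcs -muln2 big_distrl -!big_split /=; apply: eq_bigr => x _.
rewrite -!big_split !big_distrr /= big_distrl -!big_split /=.
apply: eq_bigr => y _; rewrite !inE.
by case: (x \in S); case: (y \in S); case: (sedge x y).
Qed.

Lemma nb_edges_doubling :
  nb_edges doubling + nb_edges (induced_subgraph S) = (nb_edges F).*2.
Proof. by apply: double_inj; rewrite doubleD -!nb_arcsE nb_arcs_doubling. Qed.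

(** No edge joins the two copies outside S, so each triangle lies within one of
    them. *)
Lemma doubling_triangle_free : triangle_free F -> triangle_free doubling.
Proof.
move=> F3 [x|x] [y|y] [z|z]; rewrite /sedge /= => xy yz zx;
 move: (xy) (yz) (zx);
 repeat (case/andP || move=> ?); apply: F3; eassumption.
Qed.

Definition agree_on (G : sgraph) (f g : {ffun F -> G}) : bool :=
  [forall x in S, f x == g x].

(** A homomorphism of the glued graph is a homomorphism on each copy; the two
    determine it, and must take the same values on S. *)
Lemma nb_hom_doubling (G : sgraph) :
  nb_hom doubling G =
  \sum_(f : {ffun F -> G}) \sum_(g : {ffun F -> G} | agree_on f g)
     is_hom f * is_hom g.
Proof.
rewrite nb_homE pair_big_dep /=; symmetry.
pose split (h : {ffun doubling -> G}) :=
  ([ffun x => h (inl x)] : {ffun F -> G}, [ffun x => h (copy2 x)] : {ffun F -> G}).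
pose glue (u : {ffun F -> G} * {ffun F -> G}) : {ffun doubling -> G} :=
  [ffun x : doubling => match x with inl x => u.1 x | inr x => u.2 (val x) end].
rewrite (reindex_onto split glue) /=; last first.
  move=> [f g] /= /forall_inP fg; congr pair; apply/ffunP => x; rewrite !ffunE //.
  rewrite /copy2; case: insubP => [y _ <- //|]; rewrite inE negbK => xS /=.
  exact/eqP/fg.
rewrite [LHS](eq_bigl predT) => [|h]; last first.
  apply/andP; split.
    by apply/forall_inP => x xS; rewrite !ffunE copy2_in.
  apply/eqP/ffunP => -[x|x]; rewrite !ffunE //=.
  by rewrite copy2_val.
apply: eq_bigr => h _; rewrite mulnb; congr nat_of_bool.
apply/andP/is_homP => [[/is_homP h1 /is_homP h2]|hh]; last first.
  split; apply/is_homP => x y xy; rewrite !ffunE; apply: hh => //.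
  by rewrite copy2_edge.
move=> [x|x] [y|y]; rewrite {1}/sedge /= => xy.
- by have := h1 _ _ xy; rewrite !ffunE.
- case/andP: xy => xS xy.
  by have := h2 _ _ xy; rewrite !ffunE copy2_val (copy2_in xS).
- case/andP: xy => yS xy.
  by have := h2 _ _ xy; rewrite !ffunE copy2_val (copy2_in yS).
- by have := h2 _ _ xy; rewrite !ffunE !copy2_val.
Qed.

End Double.

(** * Complete bipartite graphs *)

Section CompleteBipartite.

Definition bipartite_rel (a b : nat) (u v : 'I_a + 'I_b) : bool :=
  match u, v with inl _, inr _ | inr _, inl _ => true | _, _ => false end.

Fact bipartite_rel_sym a b : symmetric (@bipartite_rel a b).
Proof. by move=> [x|x] [y|y]. Qed.

Fact bipartite_rel_irrefl a b : irreflexive (@bipartite_rel a b).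
Proof. by move=> [x|x]. Qed.

Definition complete_bipartite a b : sgraph :=
  SGraph (@bipartite_rel_sym a b) (@bipartite_rel_irrefl a b).

Lemma card_bipartite a b : #|complete_bipartite a b| = a + b.
Proof. by rewrite card_sum !card_ord. Qed.

Lemma nb_edges_bipartite a b : nb_edges (complete_bipartite a b) = a * b.
Proof.
apply: double_inj; rewrite -nb_arcsE /nb_arcs big_sumType /=.
under eq_bigr => x _ do rewrite big_sumType /= big1_eq sum_nat_const card_ord.
under [X in _ + X]eq_bigr => x _ do
  rewrite big_sumType /= big1_eq sum_nat_const card_ord.
rewrite !sum_nat_const !card_ord /=; lia.
Qed.

Definition common_nbrs (G : sgraph) a (x : {ffun 'I_a -> G}) : {pred G} :=
  [pred z | [forall i, sedge (x i) z]].

(** Once the images x of one side are chosen, each vertex of the other side can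
    go to any common neighbour of x, independently of the others. *)
Lemma nb_hom_bipartite a b (G : sgraph) :
  nb_hom (complete_bipartite a b) G =
  \sum_(x : {ffun 'I_a -> G}) #|common_nbrs x| ^ b.
Proof.
pose glue (u : {ffun 'I_a -> G} * {ffun 'I_b -> G}) :
  {ffun complete_bipartite a b -> G} :=
  [ffun x : complete_bipartite a b => match x with inl x => u.1 x | inr x => u.2 x end].
rewrite nb_homE (reindex glue) /=; last first.
  apply: onW_bij; exists (fun h : {ffun complete_bipartite a b -> G} =>
    ([ffun i => h (inl i)], [ffun j => h (inr j)])) => [[f g]|h].
    by congr pair; apply/ffunP => i; rewrite !ffunE.
  by apply/ffunP => -[i|j]; rewrite !ffunE /= ?ffunE.
rewrite -(pair_big predT predT (fun x y => nat_of_bool (is_hom (glue (x, y))))) /=.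
apply: eq_bigr => x _; rewrite -[b in RHS]card_ord -card_ffun_on -sum1_card.
rewrite [RHS]big_mkcond /=; apply: eq_bigr => y _.
have -> : is_hom (glue (x, y)) = (y \in ffun_on (common_nbrs x)).
  apply/is_homP/ffun_onP => [h j|h [i|i] [j|j] //= _].
    by rewrite inE; apply/forallP => i; have := h (inl i) (inr j) isT; rewrite !ffunE.
  - by rewrite !ffunE /=; have /forallP := h j; exact.
  - by rewrite !ffunE /= sedge_sym; have /forallP := h i; exact.
by case: (_ \in _).
Qed.

Definition swap_sum a b (u : complete_bipartite a b) : complete_bipartite b a :=
  match u with inl x => inr x | inr x => inl x end.

Lemma swap_sum_bij a b : bijective (@swap_sum a b).
Proof. by exists (@swap_sum b a) => -[]. Qed.

Lemma swap_sum_edge a b (u v : complete_bipartite a b) :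
  sedge (swap_sum u) (swap_sum v) = sedge u v.
Proof. by case: u; case: v. Qed.

(** The 4-cycle alternates between its even and its odd vertices. *)
Definition C4_to_bipartite (i : C4) : complete_bipartite 2 2 :=
  if odd i then inr (inord i./2) else inl (inord i./2).

Lemma C4_to_bipartite_bij : bijective C4_to_bipartite.
Proof.
apply: inj_card_bij; last by rewrite card_bipartite card_ord.
move=> i j; rewrite /C4_to_bipartite.
have := odd_double_half i; have := odd_double_half j.
have hi : i./2 < 2 by case: i => -[|[|[|[|]]]].
have hj : j./2 < 2 by case: j => -[|[|[|[|]]]].
case: (odd i); case: (odd j) => // ej ei [] /(congr1 val);
  rewrite /= !inordK // => E; apply: val_inj => /=; lia.
Qed.

Lemma C4_to_bipartite_edge i j :
  sedge (C4_to_bipartite i) (C4_to_bipartite j) = sedge i j.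
Proof.
rewrite /C4_to_bipartite; case: i => -[|[|[|[|//]]]] ?; by case: j => -[|[|[|[|//]]]] ?.
Qed.

End CompleteBipartite.

(** * Removing the edges at a vertex *)

Lemma sum_fibers (T U : finType) (r : T -> U) (c : U -> nat) (a : T -> nat) :
  \sum_(x : U) (\sum_(f | r f == x) a f) * c x = \sum_f a f * c (r f).
Proof.
rewrite [RHS](partition_big r predT) //=; apply: eq_bigr => x _.
by rewrite big_distrl; apply: eq_bigr => f /eqP->.
Qed.

Lemma sum_fibers_sqr (T U : finType) (r : T -> U) (a : T -> nat) :
  \sum_(x : U) (\sum_(f | r f == x) a f) ^ 2 =
  \sum_f \sum_(g | r g == r f) a f * a g.
Proof.
under eq_bigr => x _ do rewrite -mulnn.
rewrite (sum_fibers r (fun x => \sum_(f | r f == x) a f)).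
by apply: eq_bigr => f _; rewrite big_distrr.
Qed.

Section Isolate.
Variables (F : sgraph) (v : F).

(** Keeping v as an isolated vertex, rather than deleting it, leaves F and the
    smaller graph with the same vertex type, hence the same maps to G. *)
Definition isolate_rel (x y : F) := [&& sedge x y, x != v & y != v].

Fact isolate_sym : symmetric isolate_rel.
Proof. by move=> x y; rewrite /isolate_rel sedge_sym [(y != v) && _]andbC. Qed.

Fact isolate_irrefl : irreflexive isolate_rel.
Proof. by move=> x; rewrite /isolate_rel sedge_irrefl. Qed.

Definition isolate : sgraph := SGraph isolate_sym isolate_irrefl.

Definition nbrs : {set F} := [set w | sedge v w]%SET.

Lemma isolate_triangle_free : triangle_free F -> triangle_free isolate.
Proof.
move=> F3 x y z /and3P[xy _ _] /and3P[yz _ _] /and3P[zx _ _].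
exact: (F3 x y z).
Qed.

Lemma nb_edges_isolate : nb_edges F = nb_edges isolate + #|nbrs|.
Proof.
apply: double_inj; rewrite doubleD -!nb_arcsE.
have deg : \sum_(y : F) sedge v y = #|nbrs|.
  rewrite -sum1_card [RHS]big_mkcond; apply: eq_bigr => y _.
  by rewrite inE; case: sedge.
(* An arc of F avoids v, starts at v or ends at v, and cannot do both. *)
have -> : (#|nbrs|).*2 = \sum_(x : F) \sum_(y : F)
    ((x == v) * sedge x y + (y == v) * sedge x y).
  under eq_bigr => x _ do rewrite big_split /=.
  rewrite big_split /= -addnn; congr (_ + _).
    under eq_bigr => x _ do rewrite -big_distrr /=.
    by rewrite (bigD1 v) //= eqxx mul1n deg big1 ?addn0 // => x /negbTE->.
  rewrite exchange_big /=; under eq_bigr => x _ do rewrite -big_distrr /=.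
  rewrite (bigD1 v) //= eqxx mul1n [X in _ = _ + X]big1 ?addn0 => [|x /negbTE-> //].
  by rewrite -deg; apply: eq_bigr => x _; rewrite sedge_sym.
rewrite /nb_arcs -big_split; apply: eq_bigr => x _.
rewrite -big_split; apply: eq_bigr => y _ /=.
rewrite /isolate_rel.
have [->|_] := eqVneq x v; have [->|_] := eqVneq y v; rewrite ?sedge_irrefl //.
- by rewrite andbF mul1n addn0.
- by rewrite !andbF mul1n.
- by rewrite !andbT addn0.
Qed.

Definition trace (G : sgraph) (f : {ffun isolate -> G}) : {ffun 'I_#|nbrs| -> G} :=
  [ffun i => f (enum_val i)].

Lemma agree_on_trace (G : sgraph) (f g : {ffun isolate -> G}) :
  agree_on (F := isolate) nbrs f g = (trace g == trace f).
Proof.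
apply/forall_inP/eqP => [fg|/ffunP fg x xv].
  by apply/ffunP => i; rewrite !ffunE; apply/esym/eqP/fg/enum_valP.
by have := fg (enum_rank_in xv x); rewrite !ffunE enum_rankK_in // => ->.
Qed.

(** The value at v is free in a homomorphism of [isolate], and it extends to F
    exactly when it is a common neighbour of the images of the neighbours of v;
    the factor #|G| accounts for resampling that value. *)
Lemma nb_hom_isolate (G : sgraph) :
  nb_hom F G * #|G| =
  \sum_(f : {ffun isolate -> G}) is_hom f * #|common_nbrs (trace f)|.
Proof.
(* [upd] exchanges the value of f at v with the extra vertex y. *)
pose upd (u : {ffun F -> G} * G) : {ffun F -> G} * G :=
  ([ffun x => if x == v then u.2 else u.1 x], u.1 v).
have updK : involutive upd.
  move=> [f y]; rewrite /upd /= ffunE eqxx; congr pair.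
  by apply/ffunP => x; rewrite !ffunE; case: eqP => [->|].
rewrite nb_homE big_distrl /=.
under eq_bigr => f _ do rewrite -sum1_card big_distrr /=.
rewrite pair_big /= (reindex upd) /=; last by apply: onW_bij; exists upd.
under [RHS]eq_bigr => f _ do rewrite -sum1_card big_distrr big_mkcond /=.
rewrite [RHS]pair_big /=; apply: eq_bigr => -[f y] _ /=.
rewrite muln1 -[RHS]/(if y \in common_nbrs (trace f) then is_hom (F := isolate) f * 1 else 0).
rewrite muln1 -[X in _ = if _ then X else _]mul1n.
suff -> : is_hom [ffun x => if x == v then y else f x] =
  (y \in common_nbrs (trace f)) && is_hom (F := isolate) f.
  by case: (_ \in _); rewrite ?mul1n.
apply/is_homP/andP => [h|[yf /is_homP h] a b ab].
  split.
    rewrite inE; apply/forallP => i; rewrite ffunE.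
    have := enum_valP i; rewrite inE => vi.
    have := h _ _ vi; rewrite !ffunE eqxx.
    case: eqP vi => [->|_ _]; first by rewrite sedge_irrefl.
    by rewrite sedge_sym.
  apply/is_homP => a b /and3P[ab /negbTE av /negbTE bv].
  by have := h _ _ ab; rewrite !ffunE av bv.
have nb w : sedge v w -> sedge (f w) y.
  move=> vw; have wv : w \in nbrs by rewrite inE.
  move: yf; rewrite inE => /forallP /(_ (enum_rank_in wv w)).
  by rewrite ffunE enum_rankK_in.
rewrite !ffunE; have [av|av] := eqVneq a v; have [bv|bv] := eqVneq b v.
- by move: ab; rewrite av bv sedge_irrefl.
- by rewrite sedge_sym; apply: nb; rewrite -av.
- by apply: nb; rewrite sedge_sym -bv.
- by apply: h; rewrite /sedge /= /isolate_rel ab av bv.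
Qed.

(** Two adjacent neighbours of v would form a triangle with v, so the two copies
    share no edge. *)
Lemma nb_edges_doubling_isolate : triangle_free F ->
  nb_edges (doubling (F := isolate) nbrs) = (nb_edges isolate).*2.
Proof.
move=> F3; rewrite -(nb_edges_doubling (F := isolate) nbrs).
suff -> : nb_edges (induced_subgraph (F := isolate) nbrs) = 0 by rewrite addn0.
apply: double_inj; rewrite -nb_arcsE /nb_arcs.
rewrite big1 // => x _; rewrite big1 // => y _.
apply/eqP; rewrite eqb0; apply/negP => /and3P[/and3P[xy _ _]].
by rewrite !inE => vx; rewrite sedge_sym => yv; exact: (F3 _ _ _ vx xy yv).
Qed.

End Isolate.

(** * Extensions from an induced subgraph *)

Section Restrict.
Variables (F : sgraph) (S : {set F}) (G : sgraph).

Definition restriction (f : {ffun F -> G}) : {ffun induced_subgraph S -> G} :=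
  [ffun x => f (val x)].

Lemma agree_on_restriction (f g : {ffun F -> G}) :
  agree_on S f g = (restriction g == restriction f).
Proof.
apply/forall_inP/eqP => [fg|/ffunP fg x xS].
  by apply/ffunP => x; rewrite !ffunE; apply/esym/eqP/fg/(valP x).
by have := fg (Sub x xS); rewrite !ffunE /= => ->.
Qed.

Lemma restriction_hom (f : {ffun F -> G}) : is_hom f -> is_hom (restriction f).
Proof.
by move=> /is_homP h; apply/is_homP => x y /and3P[xy _ _]; rewrite !ffunE; apply: h.
Qed.

Lemma card_ext_set (phi : {ffun induced_subgraph S -> G}) :
  #|ext_set phi| = \sum_(f | restriction f == phi) is_hom f.
Proof.
rewrite -sum1_card big_mkcond [RHS]big_mkcond; apply: eq_bigr => f _.
have -> : (f \in ext_set phi) = is_hom f && (restriction f == phi).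
  rewrite !inE; congr andb; apply/forallP/eqP => [h|<- x].
    by apply/ffunP => x; rewrite ffunE; exact/eqP.
  by rewrite ffunE.
by case: is_hom; case: (_ == _).
Qed.

Lemma ext_set_nonhom (phi : {ffun induced_subgraph S -> G}) :
  phi \notin hom_set (induced_subgraph S) G -> #|ext_set phi| = 0.
Proof.
move=> nphi; rewrite card_ext_set big1 // => f /eqP fphi.
apply/eqP; rewrite eqb0; apply: contra nphi => /restriction_hom.
by rewrite fphi inE.
Qed.

Lemma sum_ext_set :
  \sum_(phi in hom_set (induced_subgraph S) G) #|ext_set phi| = nb_hom F G.
Proof.
rewrite big_mkcond /= nb_homE.
under [RHS]eq_bigr => f _ do rewrite -[is_hom f : nat]muln1.
rewrite -(sum_fibers restriction (fun _ => 1)); apply: eq_bigr => phi _.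
by rewrite muln1 -card_ext_set; case: ifPn => // /ext_set_nonhom->.
Qed.

Lemma sum_ext_set_sqr :
  \sum_(phi in hom_set (induced_subgraph S) G) #|ext_set phi| ^ 2 =
  nb_hom (doubling S) G.
Proof.
rewrite big_mkcond nb_hom_doubling.
under [RHS]eq_bigr => f _ do under eq_bigl => g do rewrite agree_on_restriction.
rewrite -sum_fibers_sqr; apply: eq_bigr => phi _.
by rewrite -card_ext_set; case: ifPn => // /ext_set_nonhom->.
Qed.

End Restrict.

Local Open Scope ring_scope.

(** * Inequalities between densities in one graph *)

(** Lagrange's identity: twice the defect is the sum of the
    (f i * g j - f j * g i) ^+ 2. *)
Lemma Cauchy_Schwarz_sum (R : realDomainType) (T : finType) (f g : T -> R) :
  (\sum_i f i * g i) ^+ 2 <= (\sum_i f i ^+ 2) * (\sum_i g i ^+ 2).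
Proof.
suff : 0 <= ((\sum_i f i ^+ 2) * (\sum_i g i ^+ 2) - (\sum_i f i * g i) ^+ 2) *+ 2.
  by rewrite pmulrn_lge0 // subr_ge0.
have -> : ((\sum_i f i ^+ 2) * (\sum_i g i ^+ 2) - (\sum_i f i * g i) ^+ 2) *+ 2 =
   \sum_i \sum_j (f i * g j - f j * g i) ^+ 2.
  rewrite mulrnBl mulr2n {2}[(\sum_i f i ^+ 2) * _]mulrC expr2 !big_distrlr /=.
  rewrite -sumrMnl -!big_split -sumrB /=; apply: eq_bigr => i _.
  rewrite -sumrMnl -!big_split -sumrB /=; apply: eq_bigr => j _.
  ring.
by apply: sumr_ge0 => i _; apply: sumr_ge0 => j _; exact: sqr_ge0.
Qed.

Lemma ffact_le_expn n k : (n ^_ k <= n ^ k)%N.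
Proof.
elim: k => // k IH; rewrite ffactnSr expnSr; apply: leq_mul => //.
exact: leq_subr.
Qed.

(** Multiplied out by n, this bounds the proportion of non-injective maps from k
    points to n points by k ^ 2 / n. *)
Lemma ffact_lower n k : (n * n ^ k <= n * n ^_ k + k ^ 2 * n ^ k)%N.
Proof.
elim: k => [|k IH]; first by rewrite ffactn0 leq_addr.
have h := ffact_le_expn n k.
rewrite ffactnSr expnSr.
have h2 : (n ^_ k * n <= n ^_ k * (n - k) + k * n ^_ k)%N.
  by rewrite [(k * _)%N]mulnC -mulnDr leq_mul2l addnC -leq_subLR leqnn orbT.
have := leq_mul IH (leqnn n); have := leq_mul (leqnn n) h2.
have := leq_mul (leqnn (n * k)%N) h.
move: (n ^ k)%N (n ^_ k)%N (n - k)%N => P Q X {h h2 IH}.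
rewrite -!mulnn; lia.
Qed.

Section Densities.
Variables (R : realType) (p : R) (G : sgraph).
Hypotheses (p_gt0 : 0 < p) (G_gt0 : (0 < #|G|)%N).

Let n : R := #|G|%:R.
Let n_gt0 : 0 < n. Proof. by rewrite ltr0n. Qed.
Let n_neq0 : n != 0. Proof. exact: lt0r_neq0. Qed.
Let p_neq0 : p != 0. Proof. exact: lt0r_neq0. Qed.

Definition codegree a (x : {ffun 'I_a -> G}) : R :=
  #|common_nbrs x|%:R / (#|G|%:R * p ^+ a).

(** See [momentE] for the reason of the name. *)
Definition moment a b : R := t_ p (complete_bipartite a b) G.

Lemma t_homE F : (nb_hom F G)%:R = t_ p F G * (p ^+ nb_edges F * n ^+ #|F|).
Proof. by rewrite /t_ divfK // mulf_neq0 // expf_neq0. Qed.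

Lemma momentE a b :
  \sum_(x : {ffun 'I_a -> G}) codegree x ^+ b = moment a b * n ^+ a.
Proof.
rewrite /moment /t_ nb_hom_bipartite card_bipartite nb_edges_bipartite.
rewrite natr_sum 2!mulr_suml; apply: eq_bigr => x _.
rewrite natrX /codegree expr_div_n exprMn -exprM exprD -/n.
by field; rewrite !expf_neq0.
Qed.

Lemma momentC a b : moment a b = moment b a.
Proof.
have e := @nb_edges_iso _ _ _ (swap_sum_bij a b) (@swap_sum_edge a b).
have h := @nb_hom_iso _ _ _ (swap_sum_bij a b) (@swap_sum_edge a b) G.
by rewrite /moment /t_ e h !card_bipartite addnC.
Qed.

Lemma moment22 : moment 2 2 = t_ p C4 G.
Proof.
have e := nb_edges_iso C4_to_bipartite_bij C4_to_bipartite_edge.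
have h := nb_hom_iso C4_to_bipartite_bij C4_to_bipartite_edge G.
by rewrite /moment /t_ -e -h card_bipartite card_ord.
Qed.

Lemma moment11 : moment 1 1 = (nb_edges G).*2%:R / (p * n ^+ 2).
Proof.
rewrite /moment /t_ card_bipartite nb_edges_bipartite; congr (_%:R / _).
rewrite nb_hom_bipartite -nb_arcsE /nb_arcs.
rewrite (reindex (fun x : G => [ffun i : 'I_1 => x])) /=; last first.
  apply: onW_bij; exists (fun f : {ffun 'I_1 -> G} => f ord0) => [x|f].
    by rewrite ffunE.
  by apply/ffunP => i; rewrite ffunE (ord1 i).
apply: eq_bigr => x _; rewrite expn1 -sum1_card big_mkcond.
apply: eq_bigr => y _; rewrite inE.
suff -> : [forall i : 'I_1, sedge ([ffun=> x] i) y] = sedge x y by case: sedge.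
by apply/forallP/idP => [/(_ ord0)|xy i]; rewrite ffunE.
Qed.

(** The mean of (codegree - 1)^2, by [deviationE]; it is phrased through moments
    because the symmetry [momentC] is what makes it small. *)
Definition deviation a : R := moment a 2 - moment a 1 *+ 2 + 1.

Lemma deviationE a :
  \sum_(x : {ffun 'I_a -> G}) (codegree x - 1) ^+ 2 = deviation a * n ^+ a.
Proof.
rewrite /deviation mulrDl mul1r mulrBl mulrnAl -!momentE.
have -> : n ^+ a = \sum_(x : {ffun 'I_a -> G}) 1.
  by rewrite sumr_const card_ffun card_ord /n natrX.
by rewrite -sumrMnl -sumrB -big_split; apply: eq_bigr => x _ /=; ring.
Qed.

Lemma deviation_ge0 a : 0 <= deviation a.
Proof.
rewrite -(pmulr_lge0 _ (exprn_gt0 a n_gt0)) -deviationE.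
by apply: sumr_ge0 => x _; exact: sqr_ge0.
Qed.

(** Cauchy-Schwarz against the constant 1. *)
Lemma moment1_sqr a : moment a 1 ^+ 2 <= moment a 2.
Proof.
have := Cauchy_Schwarz_sum (fun x : {ffun 'I_a -> G} => 1) (fun x => codegree x ^+ 1).
under eq_bigr => x _ do rewrite mul1r.
under [X in _ <= _ * X]eq_bigr => x _ do rewrite expr1.
rewrite !momentE expr1n sumr_const card_ffun card_ord natrX -/n.
have -> : n ^+ a * (moment a 2 * n ^+ a) = moment a 2 * (n ^+ a) ^+ 2 by ring.
rewrite exprMn.
by rewrite ler_pM2r // exprn_gt0 // exprn_gt0.
Qed.

(** Cauchy-Schwarz for S^b (S - 1): bounded high moments turn concentration in
    mean square into convergence of all moments. *)
Lemma moment_succ a b :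
  (moment a b.+1 - moment a b) ^+ 2 <= moment a (b * 2) * deviation a.
Proof.
have := Cauchy_Schwarz_sum (fun x : {ffun 'I_a -> G} => codegree x ^+ b)
  (fun x => codegree x - 1).
have -> : \sum_(x : {ffun 'I_a -> G}) codegree x ^+ b * (codegree x - 1) =
    (moment a b.+1 - moment a b) * n ^+ a.
  by rewrite mulrBl -!momentE -sumrB; apply: eq_bigr => x _; rewrite exprSr; ring.
under [X in _ <= X * _]eq_bigr => x _ do rewrite -exprM.
have swap (u w : R) : u * n ^+ a * (w * n ^+ a) = u * w * (n ^+ a) ^+ 2 by ring.
rewrite momentE deviationE exprMn swap.
by rewrite ler_pM2r // exprn_gt0 // exprn_gt0.
Qed.

(** The heart of the proof.  Grouping the maps by their values x on the
    neighbours of v gives t(F) - t(F0) = E D(S - 1), with D the extension count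
    of x to F0; Cauchy-Schwarz separates D, whose second moment counts
    homomorphisms of two glued copies of F0, from S - 1. *)
Lemma isolate_ineq (F : sgraph) (v : F) : triangle_free F ->
  (t_ p F G - t_ p (isolate v) G) ^+ 2 <=
  t_ p (doubling (F := isolate v) (nbrs v)) G * deviation #|nbrs v|.
Proof.
move=> F3; set k := #|nbrs v|; set F0 := isolate v; set D := doubling _.
pose d (x : {ffun 'I_k -> G}) := (\sum_(f : {ffun F0 -> G} | trace f == x) is_hom f)%N.
pose A := p ^+ nb_edges F0 * n ^+ #|F|.
have A_gt0 : 0 < A by rewrite mulr_gt0 // exprn_gt0.
have hF : t_ p F G * A = \sum_x (d x)%:R * codegree x.
  have := congr1 (fun m : nat => m%:R : R) (nb_hom_isolate v G).
  rewrite -(sum_fibers _ (fun x => #|common_nbrs x|)) natrM t_homE natr_sum.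
  rewrite (nb_edges_isolate v) -/k exprD -/n => E.
  have -> (t x y : R) : t * (x * y) = t * (x * p ^+ k * y) * n / (n * p ^+ k).
    by field; rewrite n_neq0 expf_neq0.
  rewrite E mulr_suml; apply: eq_bigr => x _.
  by rewrite natrM mulrA.
have hF0 : t_ p F0 G * A = \sum_x (d x)%:R.
  rewrite -t_homE -natr_sum nb_homE; congr _%:R.
  under [LHS]eq_bigr => f _ do rewrite -[is_hom f : nat]muln1.
  rewrite -(sum_fibers (@trace _ v G) (fun _ => 1%N)).
  by apply: eq_bigr => x _; rewrite muln1.
have hD : t_ p D G * A ^+ 2 = (\sum_x (d x)%:R ^+ 2) * n ^+ k.
  have -> : A ^+ 2 = p ^+ nb_edges D * n ^+ #|D| * n ^+ k.
    rewrite nb_edges_doubling_isolate // -mulrA -exprD.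
    rewrite (card_doubling (F := F0)) exprMn -!exprM addnn muln2.
    by rewrite muln2.
  rewrite mulrA -t_homE; congr (_ * _).
  have -> : \sum_x (d x)%:R ^+ 2 = (\sum_x d x ^ 2)%:R :> R.
    by rewrite natr_sum; apply: eq_bigr => x _; rewrite natrX.
  rewrite nb_hom_doubling /d sum_fibers_sqr; congr _%:R.
  by apply: eq_bigr => f _; apply: eq_bigl => g; rewrite agree_on_trace.
have := Cauchy_Schwarz_sum (fun x => (d x)%:R) (fun x => codegree x - 1).
have -> : \sum_x (d x)%:R * (codegree x - 1) = (t_ p F G - t_ p F0 G) * A.
  by rewrite mulrBl hF hF0 -sumrB; apply: eq_bigr => x _; rewrite mulrBr mulr1.
have -> : (\sum_x (d x)%:R ^+ 2) * (\sum_(x : {ffun 'I_k -> G}) (codegree x - 1) ^+ 2)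
    = t_ p D G * deviation k * A ^+ 2.
  by rewrite deviationE mulrAC hD -mulrA [n ^+ k * _]mulrC.
rewrite exprMn.
by rewrite ler_pM2r // exprn_gt0.
Qed.

Lemma Chebyshev (T : finType) (A : {set T}) (Z : T -> R) (eps : R) :
  0 < eps -> (0 < #|A|)%N ->
  1 - (\sum_(x in A) (Z x - 1) ^+ 2) / #|A|%:R / eps ^+ 2 <=
  unif_prob R A (fun x => `|Z x - 1| <= eps) <= 1.
Proof.
move=> eps_gt0 A_gt0; rewrite /unif_prob.
have a_gt0 : 0 < #|A|%:R :> R by rewrite ltr0n.
apply/andP; split; last first.
  rewrite ler_pdivrMr // mul1r ler_nat; apply: subset_leq_card.
  by apply/fintype.subsetP => x; rewrite inE => /andP[].
rewrite ler_pdivlMr // mulrBl mul1r.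
have -> : (\sum_(x in A) (Z x - 1) ^+ 2) / #|A|%:R / eps ^+ 2 * #|A|%:R =
  (\sum_(x in A) (Z x - 1) ^+ 2) / eps ^+ 2.
  by field; rewrite !lt0r_neq0.
rewrite -!sum1_card !natr_sum.
rewrite [X in _ <= X](eq_bigl (fun x => (x \in A) && (`|Z x - 1| <= eps))); last first.
  by move=> x; rewrite inE.
rewrite [X in _ <= X]big_mkcondr mulr_suml -sumrB /=.
apply: ler_sum => x _; case: ifPn => [_|]; first by
  rewrite gerBl divr_ge0 // sqr_ge0.
rewrite -ltNge subr_le0 ler_pdivlMr ?exprn_gt0 // mul1r => h.
by rewrite -[X in _ <= X]real_normK ?num_real // ler_sqr ?nnegrE // ltW.
Qed.

(** The mean and second moment of Z over hom(F', G) are t(F)/t(F') and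
    t(H)/t(F'), where H is the doubling of F along S. *)
Lemma Z_deviation (F : sgraph) (S : {set F}) :
  let F' := induced_subgraph S in
  (0 < nb_hom F' G)%N ->
  (\sum_(phi in hom_set F' G) (Z_ p phi - 1) ^+ 2) / #|hom_set F' G|%:R =
  t_ p (doubling S) G / t_ p F' G - t_ p F G / t_ p F' G *+ 2 + 1.
Proof.
move=> F'; rewrite -(ltr0n R) => h_gt0.
pose c : R := n ^+ (#|F| - #|F'|) * p ^+ (nb_edges F - nb_edges F').
pose c' : R := p ^+ nb_edges F' * n ^+ #|F'|.
have c_neq0 : c != 0 by rewrite mulf_neq0 // expf_neq0.
have c'_neq0 : c' != 0 by rewrite mulf_neq0 // expf_neq0.
have hF' := t_homE F'; rewrite -/c' in hF'.
have t_neq0 : t_ p F' G != 0.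
  by apply: contraTneq h_gt0 => t0; rewrite hF' t0 mul0r ltxx.
have leF : (#|F'| <= #|F|)%N by rewrite card_induced max_card.
have lee : (nb_edges F' <= nb_edges F)%N := nb_edges_induced S.
have hF : (nb_hom F G)%:R = t_ p F G * (c * c').
  have mul_swap (x y z w : R) : x * y * (z * w) = z * x * (y * w) by ring.
  by rewrite t_homE -[in p ^+ _](subnK lee) -[in n ^+ _](subnK leF) !exprD mul_swap.
have hD : (nb_hom (doubling S) G)%:R = t_ p (doubling S) G * (c ^+ 2 * c').
  rewrite t_homE; congr (_ * _).
  have -> : nb_edges (doubling S) = ((nb_edges F - nb_edges F') * 2 + nb_edges F')%N.
    have := nb_edges_doubling S; rewrite -/F'; lia.
  have -> : #|doubling S| = ((#|F| - #|F'|) * 2 + #|F'|)%N.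
    have := card_doubling S; rewrite -(card_induced S) -/F'; lia.
  have mul_swap (x y z w : R) : x ^+ 2 * y * (z ^+ 2 * w) = (z * x) ^+ 2 * (y * w).
    by ring.
  by rewrite !exprD !exprM mul_swap.
have -> : \sum_(phi in hom_set F' G) (Z_ p phi - 1) ^+ 2 =
   (nb_hom (doubling S) G)%:R / c ^+ 2 - (nb_hom F G)%:R / c *+ 2 + (nb_hom F' G)%:R.
  rewrite -(sum_ext_set_sqr S) -(sum_ext_set S) -[nb_hom F' G]sum1_card !natr_sum.
  rewrite !mulr_suml -sumrMnl -sumrB -big_split; apply: eq_bigr => phi _ /=.
  rewrite natrX /Z_ -/n -/c; field; exact: c_neq0.
rewrite -/(nb_hom F' G) hF' hF hD.
by field; rewrite c_neq0 c'_neq0 t_neq0.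
Qed.

Lemma s_ge0 F : 0 <= s_ p F G.
Proof. by rewrite divr_ge0 ?mulr_ge0 ?exprn_ge0 // ltW. Qed.

(** Two effects separate t from s: the denominators n^k and n_(k), and the
    non-injective homomorphisms, of which there are at most n^k - n_(k). *)
Lemma s_t_dist (F : sgraph) : (#|F| <= #|G|)%N ->
  `|t_ p F G - s_ p F G| <=
  (s_ p F G + (p ^+ nb_edges F)^-1) * (#|F| ^ 2)%:R * n^-1.
Proof.
move=> le_FG; set k := #|F|; set e := nb_edges F.
pose ff : R := (#|G| ^_ k)%:R.
have ff_gt0 : 0 < ff by rewrite ltr0n ffact_gt0.
have pe_gt0 : 0 < p ^+ e by rewrite exprn_gt0.
have nk_gt0 : 0 < n ^+ k by rewrite exprn_gt0.
have hs : (nb_emb F G)%:R = s_ p F G * (p ^+ e * ff).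
  by rewrite /s_ divfK // mulf_neq0 ?lt0r_neq0.
have ht := t_homE F; rewrite -/e -/k in ht.
have h1 : (nb_emb F G)%:R <= (nb_hom F G)%:R :> R.
  by rewrite ler_nat subset_leq_card //; apply/fintype.subsetP => f; rewrite inE => /andP[].
have h2 : (nb_hom F G)%:R + ff <= (nb_emb F G)%:R + n ^+ k.
  rewrite /ff /n -natrX -!natrD ler_nat -card_inj_ffuns.
  rewrite -cardsUI addnC leq_add //; last first.
    by rewrite -card_ffun max_card.
  by apply: subset_leq_card; apply/fintype.subsetP => f; rewrite !inE.
have h3 : n ^+ k <= ff + k%:R ^+ 2 * n ^+ k / n.
  rewrite -(ler_pM2l n_gt0) mulrDr [n * (_ / n)]mulrC divfK //.
  by rewrite /ff /n -!natrX -!natrM -natrD ler_nat ffact_lower.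
have h4 : ff <= n ^+ k by rewrite /ff /n -natrX ler_nat ffact_le_expn.
pose r := k%:R ^+ 2 / n.
have r3 : n ^+ k <= ff + r * n ^+ k by rewrite /r mulrAC.
have s0 := s_ge0 F.
have -> : t_ p F G - s_ p F G = ((nb_hom F G)%:R - (nb_emb F G)%:R) / (p ^+ e * n ^+ k)
   - s_ p F G * ((n ^+ k - ff) / n ^+ k).
  rewrite ht hs; move: (t_ p F G) (s_ p F G) (p ^+ e) (n ^+ k) pe_gt0 nk_gt0.
  by move=> t s pe nk pe_gt0 nk_gt0; field; rewrite !lt0r_neq0.
have -> : (s_ p F G + (p ^+ e)^-1) * (k ^ 2)%:R * n^-1 = (p ^+ e)^-1 * r + s_ p F G * r.
  by rewrite /r natrX -mulrA mulrDl addrC.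
apply: le_trans (ler_normB _ _) _; apply: lerD.
  rewrite ger0_norm; last by rewrite divr_ge0 ?subr_ge0 // ltW ?mulr_gt0.
  rewrite ler_pdivrMr ?mulr_gt0 // mulrACA mulVf ?lt0r_neq0 // mul1r.
  rewrite lerBlDr -(lerD2r ff); apply: le_trans h2 _.
  by rewrite -addrA [leRHS]addrC -addrA lerD2l.
have q0 : 0 <= (n ^+ k - ff) / n ^+ k by rewrite divr_ge0 ?subr_ge0 // ltW.
rewrite ger0_norm; last exact: mulr_ge0.
apply: ler_wpM2l => //.
by rewrite ler_pdivrMr // lerBlDr addrC.
Qed.

End Densities.

Local Open Scope classical_set_scope.
Local Open Scope ring_scope.

(** * Limits along the sequence *)

(** The form in which every use of Cauchy-Schwarz is passed to the limit: one
    factor is bounded and the other tends to 0. *)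
Lemma cvg0_sqr_le (R : realType) (T : Type) (Fl : set_system T) {FF : Filter Fl}
    (B : R) (u b v : T -> R) :
  (\forall x \near Fl, u x ^+ 2 <= b x * v x) ->
  (\forall x \near Fl, b x <= B) -> (\forall x \near Fl, 0 <= v x) ->
  v x @[x --> Fl] --> (0 : R) -> u x @[x --> Fl] --> (0 : R).
Proof.
move=> uv bB v0 vcvg; apply/cvgr0Pnorm_lt => eps eps_gt0.
pose C := `|B| + 1.
have C_gt0 : 0 < C by rewrite ltr_wpDl.
have e2 : 0 < eps ^+ 2 / C by rewrite divr_gt0 // exprn_gt0.
have vs : \forall x \near Fl, `|v x| < eps ^+ 2 / C.
  exact: (cvgr0_norm_lt _ vcvg _ e2).
near=> x.
rewrite -ltr_sqr ?nnegrE // ?ltW // real_normK ?num_real //.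
have vx0 : 0 <= v x by near: x.
apply: (@le_lt_trans _ _ (C * v x)).
  apply: le_trans (_ : b x * v x <= _); first by near: x.
  apply: ler_wpM2r => //; apply: (@le_trans _ _ B); first by near: x.
  by rewrite /C (le_trans (ler_norm B)) // lerDl.
rewrite mulrC -ltr_pdivlMr //.
by apply: le_lt_trans (ler_norm _) _; near: x.
Unshelve. all: by end_near. Qed.

Section Sequence.
Variables (R : realType) (N : set nat) (p : nat -> R) (G : nat -> sgraph).
Hypotheses (p_range : forall n, N n -> 0 < p n <= 1)
  (p_no1 : forall eps : R, 0 < eps ->
       \forall n \near within N \oo, n%:R `^ (- eps) <= p n)
  (G_order : forall n, N n -> #|G n| = n)
  (G_size : forall n, N n -> (nb_edges (G n))%:R = p n * 'C(n, 2)%:R)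
  (G_C4 : s_ (p n) C4 (G n) @[n --> within N \oo] --> (1 : R))
  (G_bounded : forall H : sgraph, has_ubound [set s_ (p n) H (G n) | n in N]).

Local Notation "u '~>' l" := (u @ within N \oo --> (l : R)) (at level 70).

Lemma cvg_near_eq (u w : nat -> R) (l : R) :
  (\forall n \near within N \oo, u n = w n) -> u ~> l -> w ~> l.
Proof. by move=> uw; apply: cvg_trans; exact: near_eq_cvg. Qed.

Lemma cvg_of_sub (u w : nat -> R) (l : R) :
  (fun n => u n - w n) ~> 0 -> (w ~> l <-> u ~> l).
Proof.
move=> uw; split=> [wl|ul].
  apply: (@cvg_near_eq (fun n => (u n - w n) + w n)).
    by apply: nearW => n; rewrite subrK.
  by rewrite -[X in _ --> X]add0r; exact: cvgD uw wl.
apply: (@cvg_near_eq (fun n => u n - (u n - w n))).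
  by apply: nearW => n; rewrite subKr.
by rewrite -[X in _ --> X]subr0; exact: cvgB ul uw.
Qed.

Lemma near_N : \forall n \near within N \oo, N n.
Proof. exact: withinT. Qed.

Lemma near_ge m : \forall n \near within N \oo, (m <= n)%N.
Proof. by apply: cvg_within; exact: nbhs_infty_ge. Qed.

Lemma cvg_inv_nat : (fun n => n%:R^-1) ~> 0.
Proof.
apply: cvg_within_filter; apply/cvgr0Pnorm_lt => eps eps_gt0; near=> n.
have n_gt : eps^-1 < n%:R by near: n; exact: nbhs_infty_gtr.
have n_gt0 : 0 < n%:R :> R by apply: lt_trans n_gt; rewrite invr_gt0.
by rewrite ger0_norm ?invr_ge0 ?ler0n // -[eps]invrK ltf_pV2 // posrE invr_gt0.
Unshelve. all: by end_near. Qed.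

(** The only use of p = n^(-o(1)): every power of p exceeds 1/n eventually.
    With the exponent eps = 1/(2e+1) one gets p^(2e) >= p^(2e+1) >= 1/n, so the square of
    the sequence is at most 1/n. *)
Lemma cvg_inv_edges e : (fun n => (p n ^+ e)^-1 / n%:R) ~> 0.
Proof.
apply: (@cvg0_sqr_le _ _ _ _ 1 _ (fun=> 1) (fun n => n%:R^-1)) cvg_inv_nat; last 1 first.
- by apply: nearW => n; rewrite invr_ge0.
- pose d : R := (e * 2).+1%:R.
  have d_gt0 : 0 < d^-1 by rewrite invr_gt0 ltr0n.
  near=> n.
  have /andP[p_gt0 p_le1] : 0 < p n <= 1 by apply: p_range; near: n; exact: near_N.
  have n_gt0 : 0 < n%:R :> R by rewrite ltr0n; near: n; exact: near_ge.
  have n_le : n%:R^-1 <= p n ^+ (e * 2).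
    apply: (@le_trans _ _ (p n ^+ (e * 2).+1)); last first.
      by rewrite exprS ler_piMl // exprn_ge0 // ltW.
    have h : n%:R `^ (- d^-1) <= p n by near: n; exact: p_no1.
    apply: le_trans (_ : (n%:R `^ (- d^-1)) ^+ (e * 2).+1 <= _); last first.
      by rewrite lerXn2r // nnegrE ?powR_ge0 // ltW.
    rewrite -powR_mulrn ?powR_ge0 // -powRrM -/d mulNr mulVf; last first.
      by rewrite -invr_eq0 lt0r_neq0.
    by rewrite powR_inv1 // ltW.
  have pe_gt0 : 0 < p n ^+ (e * 2) by rewrite exprn_gt0.
  rewrite mul1r exprMn exprVn -exprM expr2 mulrA [_^-1 * _^-1]mulrC.
  by rewrite ler_piMl ?invr_ge0 // ler_pdivrMr // mul1r.
- exact: nearW.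
Unshelve. all: by end_near. Qed.

Lemma s_bounded F : exists B : R, forall n, N n -> s_ (p n) F (G n) <= B.
Proof. by have [B h] := G_bounded F; exists B => n Nn; apply: h; exists n. Qed.

(** Non-injective maps are a proportion O(1/n) of all maps, which remains
    negligible after division by p^e. *)
Lemma cvg_t_sub_s F : (fun n => t_ (p n) F (G n) - s_ (p n) F (G n)) ~> 0.
Proof.
have [B hB] := s_bounded F.
pose e := nb_edges F; pose c : R := (#|F| ^ 2)%:R.
apply: norm_cvg0.
apply: (@squeeze_cvgr _ _ _ _ (fun=> 0)
  (fun n => (B * c) * n%:R^-1 + c * ((p n ^+ e)^-1 / n%:R))).
- near=> n; rewrite normr_ge0 /=.
  have Nn : N n by near: n; exact: near_N.
  have /andP[p_gt0 _] := p_range Nn.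
  have le_Fn : (#|F| <= #|G n|)%N by rewrite G_order //; near: n; exact: near_ge.
  have n_gt0 : (0 < #|G n|)%N by rewrite G_order //; near: n; exact: near_ge.
  apply: le_trans (s_t_dist p_gt0 n_gt0 le_Fn) _.
  rewrite G_order // -/c -/e.
  have -> : (B * c) * n%:R^-1 + c * ((p n ^+ e)^-1 / n%:R) =
     (B + (p n ^+ e)^-1) * c * n%:R^-1 by ring.
  by rewrite !ler_wpM2r // lerD2r hB.
- exact: cvg_cst.
- rewrite -[X in _ --> X](_ : (B * c) * 0 + c * 0 = 0); last by rewrite !mulr0 addr0.
  apply: cvgD; apply: cvgM; [exact: cvg_cst|exact: cvg_inv_nat|exact: cvg_cst|].
  exact: cvg_inv_edges.
Unshelve. all: by end_near. Qed.

Lemma t_bounded F : exists B : R, \forall n \near within N \oo, t_ (p n) F (G n) <= B.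
Proof.
have [B hB] := s_bounded F; exists (B + 1).
have h : \forall n \near within N \oo, `|t_ (p n) F (G n) - s_ (p n) F (G n)| < 1.
  exact: (cvgr0_norm_lt _ (cvg_t_sub_s F) 1 ltr01).
near=> n.
have Nn : N n by near: n; exact: near_N.
have : `|t_ (p n) F (G n) - s_ (p n) F (G n)| < 1 by near: n.
have := hB n Nn.
move=> h1 /ltW /(le_trans (ler_norm _)); rewrite lerBlDr => /le_trans; apply.
by rewrite addrC lerD2r.
Unshelve. all: by end_near. Qed.

Lemma near_graph : \forall n \near within N \oo,
  [/\ N n, 0 < p n & (0 < #|G n|)%N].
Proof.
near=> n; have Nn : N n by near: n; exact: near_N.
have /andP[p_gt0 _] := p_range Nn; split => //.
by rewrite G_order //; near: n; exact: near_ge.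
Unshelve. all: by end_near. Qed.

Let mom a b n := moment (p n) (G n) a b.
Let var a n := deviation (p n) (G n) a.

(** This density is exactly 1 - 1/n, by the edge count. *)
Lemma cvg_moment11 : mom 1 1 ~> 1.
Proof.
have : (fun n => 1 - n%:R^-1) ~> 1.
  rewrite -[X in _ --> X]subr0; apply: cvgB; [exact: cvg_cst|exact: cvg_inv_nat].
apply: cvg_near_eq; near=> n.
have [Nn p_gt0 n_gt0] : [/\ N n, 0 < p n & (0 < #|G n|)%N].
  by near: n; exact: near_graph.
rewrite /mom moment11 // -mul2n natrM G_size // G_order //.
have n0 : n%:R != 0 :> R by rewrite pnatr_eq0 -lt0n -(G_order Nn).
have : ('C(n, 2) * 2)%N%:R = n%:R * (n%:R - 1) :> R.
  have := bin_ffact n 2; rewrite !factS fact0 !muln1 ffactnS ffactn1 => ->.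
  rewrite natrM -subn1 natrB //.
  by rewrite -(G_order Nn).
rewrite natrM => E.
have -> : 2 * (p n * 'C(n, 2)%:R) = p n * ('C(n, 2)%:R * 2) by ring.
by rewrite E; field; rewrite n0 lt0r_neq0.
Unshelve. all: by end_near. Qed.

Lemma cvg_moment22 : mom 2 2 ~> 1.
Proof.
have [+ _] := cvg_of_sub 1 (cvg_t_sub_s C4); move=> /(_ G_C4).
by apply: cvg_near_eq; near=> n; rewrite /mom moment22.
Unshelve. all: by end_near. Qed.

(** A cherry is the first moment of the codegrees and the second moment of the
    degrees: the latter bounds it below by t(K_{1,1})^2, the former above through
    t(K_{1,2}) <= (t(K_{1,2})^2 + 1)/2 <= (t(K_{2,2}) + 1)/2. *)
Lemma cvg_moment12 : mom 1 2 ~> 1.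
Proof.
apply: (@squeeze_cvgr _ _ _ _ (fun n => mom 1 1 n * mom 1 1 n)
  (fun n => (mom 2 2 n + 1) / 2)).
- near=> n.
  have [Nn p_gt0 n_gt0] : [/\ N n, 0 < p n & (0 < #|G n|)%N].
    by near: n; exact: near_graph.
  rewrite -expr2 moment1_sqr //=.
  have h := moment1_sqr p_gt0 n_gt0 2.
  have h2 := sqr_ge0 (mom 1 2 n - 1).
  move: h h2; rewrite /mom (momentC _ _ 2 1) sqrrB1.
  by move: (moment _ _ 1 2) (moment _ _ 2 2) => x y h; lra.
- by rewrite -[X in _ --> X](mulr1 1); apply: cvgM; exact: cvg_moment11.
- rewrite -[X in _ --> X](_ : (1 + 1) / 2 = 1 :> R); last by lra.
  by apply: cvgM; [apply: cvgD; [exact: cvg_moment22|exact: cvg_cst]|exact: cvg_cst].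
Unshelve. all: by end_near. Qed.

Lemma cvg_deviation a : mom a 1 ~> 1 -> mom a 2 ~> 1 -> var a ~> 0.
Proof.
move=> h1 h2; rewrite -[X in _ --> X](_ : 1 - 1 *+ 2 + 1 = 0 :> R); last by lra.
by apply: cvgD; [apply: cvgB => //; apply: cvgMn|exact: cvg_cst].
Qed.

Lemma cvg_moment a : mom a 1 ~> 1 -> mom a 2 ~> 1 -> forall b, mom a b.+1 ~> 1.
Proof.
move=> h1 h2; elim=> // b IH.
have [B hB] := t_bounded (complete_bipartite a (b.+1 * 2)).
have : (fun n => mom a b.+2 n - mom a b.+1 n) ~> 0.
  apply: (cvg0_sqr_le _ hB _ (cvg_deviation h1 h2)); near=> n.
    have [Nn p_gt0 n_gt0] : [/\ N n, 0 < p n & (0 < #|G n|)%N].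
      by near: n; exact: near_graph.
    exact: moment_succ.
  have [Nn p_gt0 n_gt0] : [/\ N n, 0 < p n & (0 < #|G n|)%N].
    by near: n; exact: near_graph.
  exact: deviation_ge0.
by move=> /(cvg_of_sub 1)[+ _]; exact.
Unshelve. all: by end_near. Qed.

(** For a = 1 and a = 2 all the moments tend to 1; by symmetry, this says that
    for every a the first two moments do. *)
Lemma cvg_deviation_bipartite a : (0 < a)%N -> var a ~> 0.
Proof.
have sym b c : mom b c = mom c b by apply/funext => n; exact: momentC.
case: a => // a _; apply: cvg_deviation.
  rewrite sym; apply: cvg_moment; [exact: cvg_moment11|exact: cvg_moment12].
rewrite sym; apply: cvg_moment; last exact: cvg_moment22.
by rewrite sym; exact: cvg_moment12.
Qed.

Lemma t_no_edges F : nb_edges F = 0%N -> (fun n => t_ (p n) F (G n)) ~> 1.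
Proof.
move=> F0; have : (fun n : nat => 1 : R) ~> 1 by exact: cvg_cst.
apply: cvg_near_eq; near=> n.
have [Nn p_gt0 n_gt0] : [/\ N n, 0 < p n & (0 < #|G n|)%N].
  by near: n; exact: near_graph.
rewrite /t_ F0 expr0 mul1r -natrX -card_ffun.
suff -> : nb_hom F (G n) = #|{: {ffun F -> G n}}|.
  by rewrite divff // pnatr_eq0 card_ffun -lt0n expn_gt0 n_gt0.
apply: eq_card => f; rewrite !inE; apply/is_homP => x y xy.
have := nb_arcsE F; rewrite F0 /nb_arcs => /eqP; rewrite sum_nat_eq0.
move=> /forallP /(_ x) /=; rewrite sum_nat_eq0 => /forallP /(_ y).
by rewrite xy.
Unshelve. all: by end_near. Qed.

(** Induction on the number of edges, isolating at each step a vertex of positive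
    degree. *)
Lemma cvg_t F : triangle_free F -> (fun n => t_ (p n) F (G n)) ~> 1.
Proof.
have [m] := ubnP (nb_edges F); elim: m F => // m IH F Fm F3.
have [F0|] := posnP (nb_edges F); first exact: t_no_edges.
rewrite -double_gt0 -nb_arcsE lt0n sum_nat_eq0 negb_forall => /existsP[v].
rewrite sum_nat_eq0 negb_forall => /existsP[w]; rewrite eqb0 negbK => vw.
have nb_gt0 : (0 < #|nbrs v|)%N by apply/card_gt0P; exists w; rewrite inE.
have IHv := IH (isolate v).
have [B hB] := t_bounded (doubling (F := isolate v) (nbrs v)).
have : (fun n => t_ (p n) F (G n) - t_ (p n) (isolate v) (G n)) ~> 0.
  apply: (cvg0_sqr_le _ hB _ (cvg_deviation_bipartite nb_gt0)); near=> n.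
    have [Nn p_gt0 n_gt0] : [/\ N n, 0 < p n & (0 < #|G n|)%N].
      by near: n; exact: near_graph.
    exact: isolate_ineq.
  have [Nn p_gt0 n_gt0] : [/\ N n, 0 < p n & (0 < #|G n|)%N].
    by near: n; exact: near_graph.
  exact: deviation_ge0.
have {}IHv : (fun n => t_ (p n) (isolate v) (G n)) ~> 1.
  apply: IHv; last exact: isolate_triangle_free.
  by move: Fm; rewrite (nb_edges_isolate v); lia.
by move=> /(cvg_of_sub 1)[+ _]; exact.
Unshelve. all: by end_near. Qed.

Lemma cvg_s F : triangle_free F -> (fun n => s_ (p n) F (G n)) ~> 1.
Proof. by move=> F3; have [_] := cvg_of_sub 1 (cvg_t_sub_s F); apply; exact: cvg_t. Qed.

(** Z has mean square deviation from 1 tending to 0 by [cvg_t] applied to F, F'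
    and the doubling of F; Chebyshev's inequality concludes. *)
Lemma triangle_free_flat (F : sgraph) (S : {set F}) :
  triangle_free F -> flat N p G (induced_subgraph S).
Proof.
move=> F3 eps eps_gt0; set F' := induced_subgraph S.
have cF := cvg_t F3.
have cF' := cvg_t (induced_triangle_free (S := S) F3).
have cD := cvg_t (doubling_triangle_free (S := S) F3).
pose V n := t_ (p n) (doubling S) (G n) / t_ (p n) F' (G n) -
  t_ (p n) F (G n) / t_ (p n) F' (G n) *+ 2 + 1.
have cV : V ~> 0.
  rewrite -[X in _ --> X](_ : 1 / 1 - 1 / 1 *+ 2 + 1 = 0 :> R); last by lra.
  have cI : (fun n => (t_ (p n) F' (G n))^-1) ~> 1^-1.
    by apply: cvgV cF'; exact: oner_neq0.
  apply: cvgD; last exact: cvg_cst.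
  apply: cvgB; first exact: cvgM cD cI.
  by apply: cvgMn; exact: cvgM cF cI.
apply: (@squeeze_cvgr _ _ _ _ (fun n => 1 - V n / eps ^+ 2) (fun=> 1)).
- have t_gt0 : \forall n \near within N \oo, 0 < t_ (p n) F' (G n).
    exact: (cvgr_gt 1 cF' 0 ltr01).
  near=> n.
  have [Nn p_gt0 n_gt0] : [/\ N n, 0 < p n & (0 < #|G n|)%N].
    by near: n; exact: near_graph.
  have h_gt0 : (0 < nb_hom F' (G n))%N.
    rewrite lt0n; apply/eqP => h0.
    have : 0 < t_ (p n) F' (G n) by near: n.
    by rewrite /t_ h0 mul0r ltxx.
  by rewrite /V -Z_deviation //; exact: Chebyshev.
- rewrite -[X in _ --> X](_ : 1 - 0 / eps ^+ 2 = 1 :> R); last by rewrite mul0r subr0.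
  by apply: cvgB; [exact: cvg_cst|apply: cvgM; [|exact: cvg_cst]].
- exact: cvg_cst.
Unshelve. all: by end_near. Qed.

End Sequence.

Theorem theorem3p20 (R : realType) (N : set nat) (p : nat -> R)
    (G : nat -> sgraph)
    (N_infinite : infinite_set N)
    (p_range : forall n, N n -> 0 < p n <= 1)
    (p_to0 : p n @[n --> within N \oo] --> (0 : R))
    (p_no1 : forall eps : R, 0 < eps ->
       \forall n \near within N \oo, n%:R `^ (- eps) <= p n)
    (G_order : forall n, N n -> #|G n| = n)
    (G_size : forall n, N n -> (nb_edges (G n))%:R = p n * 'C(n, 2)%:R)
    (G_C4 : s_ (p n) C4 (G n) @[n --> within N \oo] --> (1 : R))
    (G_bounded : forall H : sgraph,
       has_ubound [set s_ (p n) H (G n) | n in N])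
    (F : sgraph) (F_girth : girth_at_least F 4) :
  [/\ forall S : {set F}, S != [set: F]%SET -> flat N p G (induced_subgraph S),
      s_ (p n) F (G n) @[n --> within N \oo] --> (1 : R)
    & t_ (p n) F (G n) @[n --> within N \oo] --> (1 : R)].
Proof.
have F3 := girth4_triangle_free F_girth.
split=> [S _||].
- exact: triangle_free_flat.
- exact: cvg_s.
- exact: cvg_t.
Qed.
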